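(* Let $\mathcal{H}$ be a complex Hilbert space, let $n\geq 2$ be an integer, and let $x_1,x_2,\ldots,x_n,e\in\mathcal{H}$ with $\|e\|=1$. Then $$\left|\prod_{k=1}^n \langle x_k,e\rangle\right| \leq \frac{\left|\langle x_1,x_2\rangle \prod_{k=3}^n \langle x_k,e\rangle\right| + \prod_{k=1}^n \|x_k\|}{2}.$$
   Context: $\langle\cdot,\cdot\rangle$ denotes the inner product of $\mathcal{H}$ and $\|\cdot\|$ the corresponding norm. For $n=2$ the empty product $\prod_{k=3}^{2}$ equals $1$. *)

(* Defs.v *)
From HB Require Import structures.
From mathcomp Require Import all_boot all_order all_algebra.
From mathcomp Require Import complex.
From mathcomp Require Import all_classical all_reals all_analysis.
Set Implicit Arguments.
Unset Strict Implicit.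
Unset Printing Implicit Defensive.
Import Order.TTheory GRing.Theory Num.Theory Num.Def.
Import numFieldNormedType.Exports.
Local Open Scope ring_scope.
Local Open Scope complex_scope.

(* A complex Hilbert space over R[i]: a complete normed module whose norm is
   induced by a positive definite Hermitian form.  The form is linear in the
   first argument and conjugate-linear in the second.  Norms take values in
   R[i], where a <= b means that b - a is a nonnegative real. *)
HB.mixin Record NormedModule_isHilbert (R : realType) H
    of CompleteNormedModule R[i] H := {
  inner : {dot H for (@conjC R[i])} ;
  hnormE : forall x : H, `|x| = sqrtC (inner x x)
}.

#[short(type="hilbertType")]
HB.structure Definition Hilbert (R : realType) :=
  {H of NormedModule_isHilbert R H & CompleteNormedModule R[i] H}.

(* Main.v *)
Require Import Defs.
From mathcomp Require Import all_boot all_order all_algebra.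
From mathcomp Require Import complex.
From mathcomp Require Import all_classical all_reals all_analysis.
From mathcomp Require Import ring.
Import Order.TTheory GRing.Theory Num.Theory Num.Def.
Local Open Scope ring_scope.

(** Only the first two vectors need an idea; the others are absorbed by
    Cauchy-Schwarz, since |<x_k, e>| <= ||x_k|| ||e|| = ||x_k||.

    For two vectors the claim is Buzano's inequality
    2 |<a, e> <b, e>| <= |<a, b>| + ||a|| ||b||.
    The vector r = 2 <a, e> e - a is the reflection of a in the line spanned
    by e, so ||r|| = ||a|| ([dot_reflection]).  By linearity
    <r, b> + <a, b> = 2 <a, e> <e, b>, and the triangle inequality followed by
    Cauchy-Schwarz for r and b ([inner_le_norm]) gives the bound.

    The lemmas on a form are purely algebraic: they hold for any positive
    definite Hermitian form over a numClosedFieldType, in any dimension. *)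

Lemma dot_conj {C : numClosedFieldType} {U : lmodType C}
    (form : {dot U for @conjC C}) (u v : U) : form u v = (form v u)^*.
Proof. by rewrite hermC expr0 mul1r. Qed.

Lemma dot_scale {C : numClosedFieldType} {U : lmodType C}
    (form : {dot U for @conjC C}) (a b : C) (u v : U) :
  form (a *: u) (b *: v) = a * b^* * form u v.
Proof. by rewrite linearZl_LR linearZr_LR /= mulrA. Qed.

(** With w = <v, v> u - <u, v> v, the component of u orthogonal to v scaled by
    <v, v> to avoid a division, <w, w> is <v, v> times the difference of the two
    sides, and it is nonnegative. *)
Lemma dot_CauchySchwarz {C : numClosedFieldType} {U : lmodType C}
    (form : {dot U for @conjC C}) (u v : U) :
  `|form u v| ^+ 2 <= form u u * form v v.
Proof.
have [->|v_neq0] := eqVneq v 0; first by rewrite !linear0r normr0 expr0n.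
have v_gt0 : 0 < form v v by rewrite dnorm_gt0.
have v_conj : (form v v)^* = form v v by rewrite -dot_conj.
pose w := form v v *: u - form u v *: v.
have : 0 <= form w w := dnorm_ge0 form w.
have -> : form w w = form v v * (form u u * form v v - `|form u v| ^+ 2).
  rewrite /w dnormB !dnormZ dot_scale !normCK !rmorphM /= conjCK v_conj.
  by ring.
by rewrite pmulr_rge0 // subr_ge0.
Qed.

(** The map a |-> 2 <a, e> e - a fixes e and negates its orthogonal
    complement, hence is an isometry. *)
Lemma dot_reflection {C : numClosedFieldType} {U : lmodType C}
    (form : {dot U for @conjC C}) (a e : U) : form e e = 1 ->
  let r := (2 * form a e) *: e - a in form r r = form a a.
Proof.
move=> ee1 r; rewrite /r dnormB dnormZ ee1.
have -> : form ((2 * form a e) *: e) a = 2 * `|form a e| ^+ 2.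
  by rewrite linearZl_LR /= (dot_conj form e a) normCK mulrA.
rewrite normrM exprMn normr_nat rmorphM /= conjC_nat.
rewrite conj_Creal ?rpredX ?normr_real //.
by ring.
Qed.

Lemma inner_le_norm (R : realType) (H : hilbertType R) (u v : H) :
  `|inner u v| <= `|u| * `|v|.
Proof.
rewrite !hnormE -[leLHS]sqrCK // -sqrtCM ?nnegrE ?dnorm_ge0 //.
rewrite ler_sqrtC ?nnegrE ?mulr_ge0 ?exprn_ge0 ?dnorm_ge0 //.
exact: dot_CauchySchwarz.
Qed.

(** Cauchy-Schwarz is applied to b and the reflection r of a rather than to b
    and a; this is what makes the factor 1/2 appear. *)
Lemma Buzano_inequality (R : realType) (H : hilbertType R) (a b e : H) : `|e| = 1 ->
  `|inner a e * inner b e| <= (`|inner a b| + `|a| * `|b|) / 2.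
Proof.
move=> he.
have ee1 : inner e e = 1 by rewrite -[LHS]sqrtCK -hnormE he expr1n.
pose r := (2 * inner a e) *: e - a.
have nr : `|r| = `|a| by rewrite !hnormE; congr sqrtC; exact: dot_reflection.
have rb : inner r b = 2 * (inner a e * inner e b) - inner a b.
  by rewrite linearBl linearZl_LR /= mulrA.
rewrite ler_pdivlMr // mulrC.
have -> : 2 * `|inner a e * inner b e| = `|inner r b + inner a b|.
  by rewrite rb subrK !normrM normr_nat (dot_conj _ e b) norm_conjC.
by rewrite (le_trans (ler_normD _ _)) // addrC lerD2l -nr inner_le_norm.
Qed.

Theorem lemma2p1 (R : realType) (H : hilbertType R) (n : nat) (hn : (2 <= n)%N)
    (x : nat -> H) (e : H) (he : `|e| = 1) :
  `| \prod_(1 <= k < n.+1) inner (x k) e |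
  <= (`| inner (x 1%N) (x 2%N) * \prod_(3 <= k < n.+1) inner (x k) e |
      + \prod_(1 <= k < n.+1) `|x k|) / 2.
Proof.
have split12 (F : nat -> R[i]) : \prod_(1 <= k < n.+1) F k =
    F 1%N * F 2%N * \prod_(3 <= k < n.+1) F k.
  by rewrite big_ltn ?ltnS 1?ltnW // big_ltn ?ltnS // mulrA.
rewrite !split12 normrM [in leRHS]normrM.
set P := \prod_(3 <= k < n.+1) inner (x k) e.
set Q := \prod_(3 <= k < n.+1) `|x k|.
have PQ : `|P| <= Q.
  rewrite /P normr_prod; apply: ler_prod => k _.
  by rewrite normr_ge0 -[leRHS]mulr1 -he inner_le_norm.
have := ler_wpM2r (normr_ge0 P) (Buzano_inequality R H (x 1%N) (x 2%N) e he).
move/le_trans; apply.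
rewrite mulrAC ler_wpM2r ?invr_ge0 // mulrDl lerD2l.
by rewrite ler_wpM2l // mulr_ge0.
Qed.
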